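(* Let $R$ be a commutative unital ring, let $A$ and $B$ be unital associative $R$-algebras and let $M$ be a nonzero $(A,B)$-bimodule that is faithful as a left $A$-module and as a right $B$-module. Let $\mathcal{T}=\mathrm{Trian}(A,M,B)$ be the associated triangular algebra. Then every generalized derivation of $\mathcal{T}$ which is centralizing is a left multiplier of $\mathcal{T}$.
   Context: The triangular algebra $\mathrm{Trian}(A,M,B)$ is the set of all matrices $\begin{pmatrix} a & m\\ & b\end{pmatrix}$ with $a\in A$, $m\in M$, $b\in B$, which is a unital associative $R$-algebra under the usual matrix operations. Derivations are $R$-linear. An additive map $D:\mathcal{A}\to\mathcal{A}$ of an algebra $\mathcal{A}$ is a generalized derivation if there exists a derivation $d$ of $\mathcal{A}$ with $D(xy)=D(x)y+xd(y)$ for all $x,y\in\mathcal{A}$. A left multiplier of $\mathcal{A}$ is an additive map $F:\mathcal{A}\to\mathcal{A}$ with $F(xy)=F(x)y$ for all $x,y\in\mathcal{A}$. A map $\Theta:\mathcal{A}\to\mathcal{A}$ is centralizing if $x\Theta(x)-\Theta(x)x$ lies in the center of $\mathcal{A}$ for all $x\in\mathcal{A}$. *)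

(* Defs.v *)
From HB Require Import structures.
From mathcomp Require Import all_boot all_algebra.

Set Implicit Arguments.
Unset Strict Implicit.
Unset Printing Implicit Defensive.

Import GRing.Theory.
Local Open Scope ring_scope.

(* The last axiom states that the two actions of R on M, through A and through
   B, coincide; it is what makes Trian(A,M,B) an R-algebra.                   *)
HB.mixin Record Lmodule_isBimodule (R : comPzRingType) (A B : algType R) M
    of GRing.Lmodule A M := {
  rscale : M -> B -> M;
  rscaleA : forall m b c, rscale (rscale m b) c = rscale m (b * c);
  rscaler1 : forall m, rscale m 1 = m;
  rscalerDl : forall m n b, rscale (m + n) b = rscale m b + rscale n b;
  rscalerDr : forall m b c, rscale m (b + c) = rscale m b + rscale m c;
  lrscaleA : forall (a : A) m b, a *: rscale m b = rscale (a *: m) b;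
  scale_central : forall (r : R) m, (r%:A : A) *: m = rscale m r%:A
}.

#[short(type="bimodType")]
HB.structure Definition Bimodule (R : comPzRingType) (A B : algType R) :=
  {M of GRing.Lmodule A M & Lmodule_isBimodule R A B M}.

Notation "m *:> b" := (rscale m b) (at level 40, left associativity).

Section Faithful.
Variables (R : comPzRingType) (A B : algType R) (M : bimodType A B).

Definition left_faithful : Prop :=
  forall a : A, (forall m : M, a *: m = 0) -> a = 0.

Definition right_faithful : Prop :=
  forall b : B, (forall m : M, m *:> b = 0) -> b = 0.

Lemma rscale0r (b : B) : (0 : M) *:> b = 0.
Proof. by apply: (addIr (0 *:> b)); rewrite -rscalerDl !add0r. Qed.

Lemma rscaler0 (m : M) : m *:> (0 : B) = 0.
Proof. by apply: (addIr (m *:> 0)); rewrite -rscalerDr !add0r. Qed.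

End Faithful.

Arguments left_faithful {R A B} M.
Arguments right_faithful {R A B} M.

(* [Trian a m b] stands for the matrix with rows (a, m) and (0, b). *)
Record trian (R : comPzRingType) (A B : algType R) (M : bimodType A B) :=
  Trian { tri11 : A; tri12 : M; tri22 : B }.

Arguments Trian {R A B M} _ _ _.

Section TrianAlgebra.
Variables (R : comPzRingType) (A B : algType R) (M : bimodType A B).
Local Notation T := (trian M).
Implicit Types x y z : T.

Definition trian_tuple x : A * M * B := (tri11 x, tri12 x, tri22 x).
Definition tuple_trian (u : A * M * B) : T := Trian u.1.1 u.1.2 u.2.
Lemma trian_tupleK : cancel trian_tuple tuple_trian. Proof. by case. Qed.
HB.instance Definition _ := Choice.copy T (can_type trian_tupleK).

Definition trian_zero : T := Trian 0 0 0.
Definition trian_opp x : T := Trian (- tri11 x) (- tri12 x) (- tri22 x).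
Definition trian_add x y : T :=
  Trian (tri11 x + tri11 y) (tri12 x + tri12 y) (tri22 x + tri22 y).
Definition trian_one : T := Trian 1 0 1.
Definition trian_mul x y : T :=
  Trian (tri11 x * tri11 y)
        (tri11 x *: tri12 y + tri12 x *:> tri22 y)
        (tri22 x * tri22 y).
Definition trian_scale (r : R) x : T :=
  Trian (r *: tri11 x) ((r%:A : A) *: tri12 x) (r *: tri22 x).

Lemma trian_addA : associative trian_add.
Proof. by move=> x y z; rewrite /trian_add /= !addrA. Qed.
Lemma trian_addC : commutative trian_add.
Proof.
by move=> x y; congr Trian; [exact: addrC | exact: addrC | exact: addrC].
Qed.
Lemma trian_add0 : left_id trian_zero trian_add.
Proof. by case=> a m b; rewrite /trian_add /= !add0r. Qed.
Lemma trian_addN : left_inverse trian_zero trian_opp trian_add.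
Proof. by move=> x; rewrite /trian_add /= !addNr. Qed.
HB.instance Definition _ :=
  GRing.isZmodule.Build T trian_addA trian_addC trian_add0 trian_addN.

Lemma trian_mulA : associative trian_mul.
Proof.
move=> x y z; rewrite /trian_mul /= !mulrA; congr Trian.
by rewrite scalerDr rscalerDl scalerA lrscaleA rscaleA addrA.
Qed.
Lemma trian_mul1 : left_id trian_one trian_mul.
Proof.
by case=> a m b; rewrite /trian_mul /= !mul1r scale1r rscale0r addr0.
Qed.
Lemma trian_mulr1 : right_id trian_one trian_mul.
Proof.
by case=> a m b; rewrite /trian_mul /= !mulr1 scaler0 rscaler1 add0r.
Qed.
Lemma trian_mulDl : left_distributive trian_mul +%R.
Proof.
move=> x y z; congr Trian; rewrite /= ?mulrDl //.
by rewrite scalerDl rscalerDl addrACA.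
Qed.
Lemma trian_mulDr : right_distributive trian_mul +%R.
Proof.
move=> x y z; congr Trian; rewrite /= ?mulrDr //.
by rewrite scalerDr rscalerDr addrACA.
Qed.
Lemma trian_1neq0 : trian_one != 0.
Proof. by apply/eqP => -[/eqP]; rewrite oner_eq0. Qed.
HB.instance Definition _ := GRing.Zmodule_isNzRing.Build T
  trian_mulA trian_mul1 trian_mulr1 trian_mulDl trian_mulDr trian_1neq0.

Lemma trian_scaleA r s x :
  trian_scale r (trian_scale s x) = trian_scale (r * s) x.
Proof. by rewrite /trian_scale /= !scalerA -scalerAl mul1r scalerA. Qed.
Lemma trian_scale1 : left_id 1 trian_scale.
Proof. by case=> a m b; rewrite /trian_scale /= !scale1r. Qed.
Lemma trian_scaleDr : right_distributive trian_scale +%R.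
Proof. by move=> r x y; congr Trian; rewrite /= scalerDr. Qed.
Lemma trian_scaleDl x : {morph trian_scale^~ x : r s / r + s}.
Proof. by move=> r s; congr Trian; rewrite /= !scalerDl. Qed.
HB.instance Definition _ := GRing.Zmodule_isLmodule.Build R T
  trian_scaleA trian_scale1 trian_scaleDr trian_scaleDl.

Lemma trian_scaleAl (r : R) x y : r *: (x * y) = (r *: x) * y.
Proof.
congr Trian; rewrite /= ?scalerAl //.
by rewrite scalerDr scalerA -lrscaleA -!scalerAl mul1r.
Qed.
HB.instance Definition _ := GRing.Lmodule_isLalgebra.Build R T trian_scaleAl.

Lemma trian_scaleAr (r : R) x y : r *: (x * y) = x * (r *: y).
Proof.
congr Trian; rewrite /= ?scalerAr //.
rewrite scalerDr !scalerA -scalerAl mul1r -scalerAr mulr1.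
by rewrite scale_central rscaleA -scalerAr mulr1.
Qed.
HB.instance Definition _ := GRing.Lalgebra_isAlgebra.Build R T trian_scaleAr.

End TrianAlgebra.

Definition central (S : pzRingType) (z : S) : Prop :=
  forall y, GRing.comm z y.

Definition derivation (R : comPzRingType) (S : algType R) (d : S -> S) : Prop :=
  linear d /\ forall x y, d (x * y) = d x * y + x * d y.

Definition generalized_derivation (R : comPzRingType) (S : algType R)
    (D : S -> S) : Prop :=
  {morph D : x y / x + y} /\
  exists d : S -> S, derivation d /\ forall x y, D (x * y) = D x * y + x * d y.

Definition left_multiplier (S : pzRingType) (F : S -> S) : Prop :=
  {morph F : x y / x + y} /\ forall x y, F (x * y) = F x * y.

Definition centralizing (S : pzRingType) (f : S -> S) : Prop :=
  forall x, central (x * f x - f x * x).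

(* Main.v *)
(** Write D x = q x + d x with q = D 1, and let e = diag(1, 0). Central elements
    of T have vanishing (1,2) entry, while [e, z] is the (1,2) part of z; so
    knowing that a commutator with e is central kills a (1,2) entry. Polarizing
    the hypothesis at (x, 1) gives [x, q] central for all x; taking x = e and
    then x strictly upper triangular, faithfulness shows that q is central.
    Hence [x, d x] = [x, D x] is central. Evaluating at e gives d e = 0, and
    polarizing at (e, x) then shows that d x has zero (1,2) entry. So d vanishes
    on strictly upper triangular matrices, and by faithfulness everywhere. *)
Require Import Defs.
From HB Require Import structures.
From mathcomp Require Import all_boot all_algebra.

Set Implicit Arguments.
Unset Strict Implicit.
Unset Printing Implicit Defensive.

Import GRing.Theory.
Local Open Scope ring_scope.

Lemma centralB (S : pzRingType) (u v : S) :
  central u -> central v -> central (u - v).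
Proof. by move=> cu cv y; apply/commr_sym/commrB; apply/commr_sym. Qed.

(** Expand the commutator of [x + y] with [f (x + y)] biadditively; its two diagonal terms are
    central, hence so is the sum of the mixed ones. *)
Lemma centralizing_polar (S : pzRingType) (f : S -> S) x y :
  {morph f : u v / u + v} -> centralizing f ->
  central ((x * f y - f y * x) + (y * f x - f x * y)).
Proof.
move=> fD fC.
pose c u v := u * v - v * u : S.
have cDl u v w : c (u + v) w = c u w + c v w.
  by rewrite /c mulrDl mulrDr opprD addrACA.
have cDr u v w : c u (v + w) = c u v + c u w.
  by rewrite /c mulrDl mulrDr opprD addrACA.
have -> : (x * f y - f y * x) + (y * f x - f x * y) =
    c (x + y) (f (x + y)) - c x (f x) - c y (f y).
  by rewrite fD cDl !cDr [RHS]addrAC [in RHS]addrA addrK [RHS]addrC -[in RHS]addrA addKr.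
exact: centralB (centralB (fC _) (fC _)) (fC _).
Qed.

Lemma linear_morphD (R : pzRingType) (U V : lmodType R) (d : U -> V) :
  linear d -> {morph d : x y / x + y}.
Proof. by move=> d_lin x y; have := d_lin 1 x y; rewrite !scale1r. Qed.

Section Triangular.
Variables (R : comPzRingType) (A B : algType R) (M : bimodType A B).
Local Notation T := (trian M).
Implicit Types x y z : T.

Definition trian_idem : T := Trian 1 0 0.
Definition trian_up (m : M) : T := Trian 0 m 0.

Lemma trian_addE x y :
  x + y = Trian (tri11 x + tri11 y) (tri12 x + tri12 y) (tri22 x + tri22 y).
Proof. by []. Qed.

Lemma trian_oppE x : - x = Trian (- tri11 x) (- tri12 x) (- tri22 x).
Proof. by []. Qed.

Lemma trian_mulE x y :
  x * y = Trian (tri11 x * tri11 y) (tri11 x *: tri12 y + tri12 x *:> tri22 y)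
                (tri22 x * tri22 y).
Proof. by []. Qed.

Lemma trian0E : (0 : T) = Trian 0 0 0. Proof. by []. Qed.

Definition trianE := (trian_addE, trian_oppE, trian_mulE).

Definition act0 := (scale0r, scaler0, @rscale0r R A B M, @rscaler0 R A B M,
  mul0r, mulr0, add0r, addr0, subr0, sub0r).

Lemma comm_idem_tri12 z : tri12 (trian_idem * z - z * trian_idem) = tri12 z.
Proof. by rewrite !trianE /= !act0 scale1r. Qed.

Lemma central_tri12 z : central z -> tri12 z = 0.
Proof. by move=> cz; rewrite -comm_idem_tri12 cz subrr. Qed.

Lemma trian_mul_up x m : x * trian_up m = trian_up (tri11 x *: m).
Proof. by rewrite trianE /= !act0. Qed.

Lemma trian_up_mul x m : trian_up m * x = trian_up (m *:> tri22 x).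
Proof. by rewrite trianE /= !act0. Qed.

Hypotheses (M_lfaithful : left_faithful M) (M_rfaithful : right_faithful M).

Lemma trian_central (q : T) :
  tri12 q = 0 -> (forall m : M, tri11 q *: m = m *:> tri22 q) -> central q.
Proof.
case: q => a n b /= -> ab [a' m b'].
rewrite /GRing.comm !trianE /= !act0 ab; congr Trian.
(* On each [k], a(a'k) = (a'k)b = a'(kb) = a'(ak), so the commutator of a and a' annihilates M; the
   (2,2) entry is symmetric. *)
- apply/eqP; rewrite -subr_eq0; apply/eqP/M_lfaithful => k.
  by rewrite scalerBl -!scalerA !ab lrscaleA subrr.
- apply/eqP; rewrite -subr_eq0; apply/eqP/M_rfaithful => k.
  have rscalerN (c : B) : k *:> - c = - (k *:> c).
    by apply: (addIr (k *:> c)); rewrite -rscalerDr !addNr rscaler0.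
  by rewrite rscalerDr rscalerN -!rscaleA -!ab lrscaleA subrr.
Qed.

Lemma comm_central_trian (q : T) :
  (forall x, central (x * q - q * x)) -> central q.
Proof.
move=> cq; apply: trian_central => [|m].
  by rewrite -comm_idem_tri12; apply/central_tri12/cq.
(* The (1,2) entry of this commutator is the difference of the actions of [tri22 q] and [tri11 q] on
   [m]. *)
have /central_tri12 := cq (trian_up m).
rewrite trian_mul_up trian_up_mul /= => /eqP.
by rewrite subr_eq0 eq_sym => /eqP.
Qed.

Lemma centralizing_derivation_eq0 (d : T -> T) :
  {morph d : x y / x + y} -> (forall x y, d (x * y) = d x * y + x * d y) ->
  centralizing d -> forall x, d x = 0.
Proof.
move=> dD dM dC.
set e := trian_idem.
have ee : e * e = e by rewrite trianE /= !act0 mulr1.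
have d0 : d 0 = 0 by apply: (addIr (d 0)); rewrite -dD !add0r.
have de : d e = 0.
  have de12 : tri12 (d e) = 0.
    by rewrite -comm_idem_tri12; apply/central_tri12/dC.
  (* Diagonal entries of d e = (d e)e + e(d e) read a = a + a and b = 0. *)
  have := dM e e; rewrite ee; case: (d e) de12 => a m b /= ->.
  rewrite !trianE /= !act0 mulr1 mul1r => -[/eqP].
  by rewrite -subr_eq0 opprD addNKr oppr_eq0 => /eqP -> ->.
have d12 x : tri12 (d x) = 0.
  have := central_tri12 (centralizing_polar e x dD dC).
  by rewrite de mulr0 mul0r subrr addr0 comm_idem_tri12.
have dup m : d (trian_up m) = 0.
  have e_up : e * trian_up m = trian_up m by rewrite trian_mul_up scale1r.
  have up_e : trian_up m * e = 0 by rewrite trian_up_mul /= rscaler0.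
  (* With u = [trian_up m], eu = u gives d u = e(d u), killing the (2,2) entry; ue = 0 gives (d u)e
     = 0, killing the (1,1) entry. *)
  have := dM (trian_up m) e; have := dM e (trian_up m).
  rewrite e_up up_e de d0 mul0r mulr0 add0r addr0.
  have := d12 (trian_up m); case: (d _) => a n b /= ->.
  rewrite !trianE trian0E /= !act0 mulr1 => -[_ ->].
  by case=> <-.
move=> x.
have d11 : tri11 (d x) = 0.
  (* Both x u and u have zero derivative, so (d x)u = 0. *)
  apply: M_lfaithful => m; have := dM x (trian_up m).
  by rewrite trian_mul_up !dup mulr0 addr0 trian_mul_up => -[].
have d22 : tri22 (d x) = 0.
  apply: M_rfaithful => m; have := dM (trian_up m) x.
  by rewrite trian_up_mul !dup mul0r add0r trian_up_mul => -[].
by move: d11 (d12 x) d22; case: (d x) => a m b /= -> -> ->.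
Qed.

End Triangular.

Theorem theorem5p4 (R : comPzRingType) (A B : algType R) (M : bimodType A B)
    (M_neq0 : exists m : M, m <> 0)
    (M_lfaithful : left_faithful M) (M_rfaithful : right_faithful M)
    (D : trian M -> trian M) :
  generalized_derivation D -> centralizing D -> left_multiplier D.
Proof.
move=> [DD [d [[d_lin dM] DM]]] DC; split=> // x y.
have Dq z : D z = D 1 * z + d z by rewrite -[in LHS](mul1r z) DM mul1r.
have q_central : central (D 1).
  apply: comm_central_trian => // z.
  have := centralizing_polar z 1 DD DC.
  by rewrite mul1r mulr1 subrr addr0.
have dC : centralizing d.
  move=> z; have := DC z.
  (* Centrality of [D 1] cancels z(D 1)z against (D 1)zz. *)
  rewrite Dq mulrDr mulrDl mulrA -(q_central z) opprD addrACA.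
  by rewrite subrr add0r.
have d_eq0 := centralizing_derivation_eq0 M_lfaithful M_rfaithful
  (linear_morphD d_lin) dM dC.
by rewrite DM d_eq0 mulr0 addr0.
Qed.
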